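(* Let $\kappa$ be an uncountable cardinal. If $\kappa \in \mathfrak{sp}(\text{Borel})$, then $\mathfrak{par}(\kappa^\omega) \in \mathfrak{sp}(\text{Borel})$.
   Context: $\mathfrak{sp}(\text{Borel}) = \{|\mathcal{P}| : \mathcal{P} \text{ is a partition of } \mathbb{R} \text{ into uncountably many Borel sets}\}$. The cardinal $\kappa$ has the discrete topology and $\kappa^\omega$ the product topology. For a topological space $X$, $\mathfrak{par}(X) = \min\{|\mathcal{P}| : \mathcal{P} \text{ is a partition of } X \text{ into Polish subspaces}\}$. *)

(* Defs.v *)
From HB Require Import structures.
From mathcomp Require Import all_boot all_order all_algebra.
From mathcomp Require Import all_classical all_reals all_analysis.

Set Implicit Arguments.
Unset Strict Implicit.
Unset Printing Implicit Defensive.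

Import Order.TTheory GRing.Theory Num.Theory.
Import numFieldNormedType.Exports.

Local Open Scope classical_set_scope.
Local Open Scope ring_scope.
Local Open Scope card_scope.

(* Cardinals are represented by sets, up to the equipotence [#=] and ordered by
   [#<=]. A partition is a set [P] of blocks (the library's indexed [partition]
   taken at the identity family), so that its cardinality is that of [P]. *)

(* [sp_Borel R A] reads |A| \in sp(Borel). *)
Definition sp_Borel (R : realType) (T : Type) (A : set T) : Prop :=
  exists P : set (set R),
    [/\ partition P id [set: R],
        P `<=` <<s @open R >>,
        ~ countable P
      & P #= A].

Definition is_metric (R : realType) (X : Type) (d : X -> X -> R) : Prop :=
  [/\ forall x y, d x y = 0 <-> x = y,
      forall x y, d x y = d y x
    & forall x y z, d x z <= d x y + d y z].

Definition metric_induces (R : realType) (X : topologicalType)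
    (d : X -> X -> R) : Prop :=
  forall U : set X, open U <->
    forall x, U x -> exists2 e : R, 0 < e & [set y | d x y < e] `<=` U.

Definition metric_cauchy_seq (R : realType) (X : Type) (d : X -> X -> R)
    (u : nat -> X) : Prop :=
  forall e : R, 0 < e ->
    exists N : nat, forall m n, (N <= m)%N -> (N <= n)%N -> d (u m) (u n) < e.

Definition metric_complete (R : realType) (X : Type) (d : X -> X -> R) : Prop :=
  forall u : nat -> X, metric_cauchy_seq d u ->
    exists x : X, forall e : R, 0 < e ->
      exists N : nat, forall n, (N <= n)%N -> d (u n) x < e.

Definition completely_metrizable (R : realType) (X : topologicalType) : Prop :=
  exists d : X -> X -> R, [/\ is_metric d, metric_induces d & metric_complete d].

Definition separable_space (X : topologicalType) : Prop :=
  exists2 D : set X, countable D & dense D.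

Definition polish_space (R : realType) (X : topologicalType) : Prop :=
  separable_space X /\ completely_metrizable R X.

(* The block [A] is coerced to the subtype of its elements, whose topology is
   the subspace topology (unlike the library's [subspace A]). *)
Definition polish_partition (R : realType) (X : topologicalType)
    (P : set (set X)) : Prop :=
  partition P id [set: X] /\ forall A : set X, P A -> polish_space R A.

Definition min_polish_partition (R : realType) (X : topologicalType)
    (P : set (set X)) : Prop :=
  polish_partition R P /\
  forall Q : set (set X), polish_partition R Q -> P #<= Q.

(* The cardinal par(X), represented by a chosen partition of least cardinality;
   [parP] shows that there is one. *)
Definition par (R : realType) (X : topologicalType) : set (set X) :=
  [get P | @min_polish_partition R X P].
Arguments par : clear implicits.

Lemma card_le_wf (T : pointedType) (S : set (set T)) :
  S !=set0 -> exists2 P, S P & forall Q, S Q -> P #<= Q.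
Proof.
move=> [Q0 SQ0].
pose Z := [set M : set (set T -> T) |
  (forall f Q, M f -> S Q -> Q (f Q)) /\
  (forall f g Q, M f -> M g -> S Q -> f Q = g Q -> f = g)].
have [|M [[ZM1 ZM2] Mmax]] := @Zorn_bigcup _ Z.
  move=> F FZ Ftot; split=> [f Q [M FM Mf] SQ|f g Q [M FM Mf] [N FN Ng] SQ fg].
    by have [FZ1 _] := FZ _ FM; exact: (FZ1 f Q Mf SQ).
  have [MN|NM] := Ftot _ _ FM FN.
    by have [_ FZ2] := FZ _ FN; exact: (FZ2 f g Q (MN _ Mf) Ng SQ fg).
  by have [_ FZ2] := FZ _ FM; exact: (FZ2 f g Q Mf (NM _ Ng) SQ fg).
have [[P SP PM]|noP] :=
    pselect (exists2 P, S P & P `<=` [set f P | f in M]).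
  exists P => // Q SQ.
  apply: (card_le_trans (subset_card_le PM)).
  apply: (card_le_trans (card_image_le _ _)).
  have inj : {in M &, injective (fun f : set T -> T => f Q)}.
    by move=> f g /set_mem Mf /set_mem Mg; exact: (ZM2 f g Q Mf Mg SQ).
  have := inj_card_eq inj; rewrite card_eq_sym => /card_eqPle[MQ _].
  apply: (card_le_trans MQ); apply: subset_card_le => _ [f Mf <-].
  exact: (ZM1 f Q Mf SQ).
have /choice[a aP] : forall Q, exists x, S Q -> Q x /\ ~ [set f Q | f in M] x.
  move=> Q; have [SQ|] := pselect (S Q); last by exists point.
  apply: contrapT => nx; apply: noP; exists Q => // x Qx.
  by apply: contrapT => nMx; apply: nx; exists x.
exfalso; apply: (Mmax (M `|` [set a])).
  split; first by move=> f Mf; left.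
  move=> /(_ a (or_intror erefl)) Ma.
  by have [_] := aP _ SQ0; apply; exists a.
split=> [f Q [Mf|->] SQ|f g Q [Mf|->] [Mg|->] SQ //].
- exact: (ZM1 f Q Mf SQ).
- by have [] := aP _ SQ.
- exact: (ZM2 f g Q Mf Mg SQ).
- by move=> fa; have [_] := aP _ SQ; case; exists f.
- by move=> ag; have [_] := aP _ SQ; case; exists g.
Qed.

Lemma polish_space_set1 (R : realType) (X : topologicalType) (x : X) :
  polish_space R [set x].
Proof.
have e (a b : [set x]) : a = b.
  apply: val_inj; case: a => a /= /set_mem; case: b => b /= /set_mem.
  by move=> -> ->.
split.
  exists [set: [set x]]; last by move=> O [y Oy] _; exists y.
  apply: finite_set_countable.
  exact: sub_finite_set (finite_set1 (exist _ x (mem_set erefl))).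
exists (fun _ _ => 0); split.
- by split=> // a b; rewrite addr0.
- move=> U; split=> [_ a Ua|_].
    by exists 1 => // b _; rewrite (e b a).
  have [[a Ua]|U0] := pselect (U !=set0).
    suff -> : U = setT by exact: openT.
    by apply/seteqP; split=> // b _; rewrite (e b a).
  suff -> : U = set0 by exact: open0.
  by apply/seteqP; split=> // b Ub; apply: U0; exists b.
- move=> u _; exists (u 0%N) => r r0.
  by exists 0%N.
Qed.

Lemma parP (R : realType) (X : topologicalType) :
  min_polish_partition R (par R X).
Proof.
apply: (@getPex _ (@min_polish_partition R X)).
have [|P pP Pmin] := @card_le_wf _ [set P | @polish_partition R X P].
  exists (range set1); split; last first.
    by move=> _ [x _ <-]; exact: polish_space_set1.
  split.
  - by apply/seteqP; split=> // x _; exists [set x].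
  - by move=> _ _ [x _ <-] [y _ <-] [_ [-> ->]].
  - by move=> _ [x _ <-]; exists x.
by exists P.
Qed.

(* Main.v *)
(* Let [f : R -> K] send a real to the index of its block. Composing [f],
   coordinatewise, with a Borel surjection [R -> R^nat] gives a surjection
   [psi : R -> K^nat] such that each [psi r n = k] is a Borel condition on [r].
   A Polish subspace of [K^nat] is a countable intersection of countable unions
   of cylinders (the cylinders centred in a countable dense set on which the
   complete metric oscillates little), so its preimage under [psi] is Borel, and
   the preimages of the blocks of a least Polish partition of [K^nat] partition
   [R]. There are uncountably many, since countably many separable subspaces
   only have countably many 0-th coordinates. *)
Require Import Defs.
From mathcomp Require Import all_boot all_order all_algebra.
From mathcomp Require Import all_classical all_reals all_analysis.
From mathcomp Require Import measurable_realfun ring lra.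

Import Order.TTheory GRing.Theory Num.Theory.
Import numFieldNormedType.Exports.

Local Open Scope classical_set_scope.
Local Open Scope ring_scope.
Local Open Scope card_scope.

(** * A Borel surjection from the reals onto sequences of reals *)

Fixpoint quaternary (b : nat -> bool) (k : nat) : nat :=
  if k is j.+1 then (4 * quaternary b j + b k)%N else b 0%N.

Lemma odd_quaternary (b : nat -> bool) (k : nat) : odd (quaternary b k) = b k.
Proof. by case: k => [|k]; rewrite ?oddb//= oddD oddM /= oddb. Qed.

(** Since 4 is even, for [0 <= r] and [0 < k] this is the parity of the [k]-th base 4 digit of [r]
    after the point. *)
Definition bit {R : realType} (k : nat) (r : R) : bool :=
  odd `|Num.floor (4 ^+ k * r)|%N.

(* [r = \sum_j b j / 4 ^ j]; base 4 with digits 0 and 1 leaves no ambiguity. *)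
Lemma bit_surj {R : realType} (b : nat -> bool) :
  exists r : R, forall k, bit k r = b k.
Proof.
pose S k : R := (quaternary b k)%:R / 4 ^+ k.
(* The digits after place [k] add at most the geometric tail [1/3 / 4 ^+ k]; as [1/3 < 1], they do
   not change the floor. *)
pose T k : R := ((quaternary b k)%:R + 1/3) / 4 ^+ k.
have p4 k : (0 : R) < 4 ^+ k by rewrite exprn_gt0.
have ST k : S k <= T k by rewrite ler_pM2r ?invr_gt0// lerDl; lra.
have Sle m n : (m <= n)%N -> S m <= S n.
  apply: (homo_leq (@lexx _ R) (@le_trans _ R)) => k.
  rewrite -subr_ge0 (_ : S k.+1 - S k = (b k.+1)%:R / 4 ^+ k.+1).
    by rewrite divr_ge0.
  by rewrite /S [quaternary b k.+1]/= natrD natrM exprS; field; rewrite gt_eqF.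
have Tle m n : (m <= n)%N -> T n <= T m.
  apply: (homo_leq (r := fun x y : R => y <= x)) => [//|y x z yx zy|k].
    exact: le_trans zy yx.
  rewrite -subr_ge0 (_ : T k - T k.+1 = (1 - (b k.+1)%:R) / 4 ^+ k.+1).
    by rewrite divr_ge0// subr_ge0; case: (b _).
  by rewrite /T [quaternary b k.+1]/= natrD natrM exprS; field; rewrite gt_eqF.
have STle m n : S m <= T n.
  have [mn|/ltnW nm] := leqP m n.
    exact: le_trans (Sle _ _ mn) (ST n).
  exact: le_trans (ST m) (Tle _ _ nm).
exists (sup (range S)) => k; rewrite /bit.
have S0 : range S !=set0 by exists (S 0); exists 0.
have le1 : S k <= sup (range S).
  apply: ub_le_sup; last by exists k.
  by exists (T 0) => _ [n _ <-].
have le2 : sup (range S) <= T k.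
  by apply: ge_sup => // _ [n _ <-].
rewrite (@floor_def _ _ (quaternary b k)%:Z) ?absz_nat ?odd_quaternary//.
move: le1 le2; rewrite ler_pdivrMr// ler_pdivlMr// mulrC intrD -pmulrn => *.
by apply/andP; split; lra.
Qed.

Lemma measurable_bit {R : realType} (k : nat) :
  measurable_fun [set: R] (bit k : R -> bool).
Proof.
apply: (measurable_fun_bool true); rewrite setTI.
rewrite (_ : _ @^-1` _ = \bigcup_(z : int)
    if odd `|z|%N then ( *%R (4 ^+ k)) @^-1` `[z%:~R, (z + 1)%:~R[ else set0).
  apply: countable_bigcupT_measurable => // z; case: ifP => // _.
  by rewrite -[X in measurable X]setTI; apply: mulrl_measurable.
apply/seteqP; split=> [r /= rk|r [z _]].
  exists (Num.floor (4 ^+ k * r)) => //=; rewrite [odd _]rk /=.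
  by rewrite in_itv /= floor_itv.
by case: ifPn => // oz; rewrite /= in_itv /= => /floor_def zr; rewrite /bit zr.
Qed.

Definition enum_rat {R : realType} (k : nat) : R :=
  ratr (odflt 0 (unpickle k : option rat)).

(** The bits numbered by the pairs [(n, k)] mark a set of rationals, whose supremum is taken. An
    unmarked index contributes [-oo], which leaves the supremum unchanged; [fine] turns an infinite
    supremum into 0. *)
Definition real_of_bits {R : realType} (n : nat) (r : R) : R :=
  fine (esups (fun k => if bit (pickle (n, k)) r then (@enum_rat R k)%:E
                        else -oo)%E 0%N).

Lemma measurable_real_of_bits {R : realType} (n : nat) :
  measurable_fun [set: R] (real_of_bits n : R -> R).
Proof.
apply: measurableT_comp; first exact: fine_measurable.
apply: (measurable_fun_esups (f := fun k r => if bit (pickle (n, k)) r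
  then (@enum_rat R k)%:E else -oo%E)) => k.
by apply: measurable_fun_ifT => //; exact: measurable_bit.
Qed.

Lemma real_of_bits_surj {R : realType} (x : nat -> R) :
  exists r : R, forall n, real_of_bits n r = x n.
Proof.
(* The rationals marked for [n] form the lower cut of [x n], so one bit sequence stores all the cuts
   at once. *)
pose b m := if unpickle m is Some (n, k) then enum_rat k < x n else false.
have [r rb] := bit_surj (R := R) b; exists r => n.
rewrite /real_of_bits; suff -> : esups (fun k => if bit (pickle (n, k)) r then (@enum_rat R k)%:E
                          else -oo)%E 0%N = (x n)%:E by [].
apply/eqP; rewrite eq_le; apply/andP; split.
  apply: ge_ereal_sup => _ [k _ <-]; rewrite rb /b pickleK.
  by case: ifPn => [/ltW|]; rewrite ?lee_fin// leNye.
apply/lee_subgt0Pr => e e0; rewrite -EFinB.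
have [q] := @rat_in_itvoo R (x n - e) (x n) ltac:(by rewrite ltrBlDr ltrDl).
rewrite in_itv /= => /andP[eq qx].
have kq : enum_rat (pickle q) = ratr q :> R by rewrite /enum_rat pickleK.
apply: (@le_trans _ _ (ratr q : R)%:E); first by rewrite lee_fin ltW.
apply: ereal_sup_ubound; exists (pickle q) => //=.
by rewrite rb /b pickleK kq qx.
Qed.

Lemma borel_measurable {R : realType} (A : set R) :
  <<s @open R >> A <-> measurable A.
Proof.
split.
  apply: smallest_sub; first exact: sigma_algebra_measurable.
  by move=> U /open_measurable.
move=> mA; have : (@RGenOpens.G R).-sigma.-measurable A.
  by rewrite -RGenOpens.measurableE.
apply: smallest_sub; first exact: smallest_sigma_algebra.
by move=> _ [x [y ->]]; apply: sub_sigma_algebra; exact: interval_open.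
Qed.

(** * Cylinders and the product topology *)

Notation sequence_space K := (prod_topology (fun _ : nat => discrete_topology K)).

Definition cylinder {K : choiceType} (x : sequence_space K) (m : nat) :
    set (sequence_space K) :=
  [set y | forall i, (i < m)%N -> y i = x i].

Lemma sub_cylinder {K : choiceType} (x : sequence_space K) (m n : nat) :
  (m <= n)%N -> cylinder x n `<=` cylinder x m.
Proof. by move=> mn y yx i im; apply: yx; exact: leq_trans mn. Qed.

Lemma cylinder_eq {K : choiceType} (x y : sequence_space K) (m : nat) :
  cylinder x m y -> cylinder y m = cylinder x m.
Proof.
by move=> xy; apply/seteqP; split=> z h i im; rewrite h// xy.
Qed.

Lemma cylinder_open {K : choiceType} (x : sequence_space K) (m : nat) :
  open (cylinder x m).
Proof.
elim: m => [|m IH].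
  rewrite (_ : cylinder x 0 = setT); first exact: openT.
  by apply/seteqP; split.
rewrite (_ : cylinder x m.+1 = cylinder x m `&`
    (@proj nat (fun=> discrete_topology K) m) @^-1` [set x m]).
  apply: openI => //; apply: open_comp; last exact: discrete_open.
  by move=> y _; exact: proj_continuous.
apply/seteqP; split=> [y yx|y [yx ym] i].
  by split; [move=> i im; exact/yx/ltnW|exact: yx].
by rewrite ltnS leq_eqVlt => /orP[/eqP->//|/yx].
Qed.

(** Convergence of the filter of cylinders to [x] is tested on one coordinate at a time, and length
    [i.+1] already fixes coordinate [i]. *)
Lemma open_cylinder {K : choiceType} (U : set (sequence_space K))
    (x : sequence_space K) :
  open U -> U x -> exists m, cylinder x m `<=` U.
Proof.
move=> oU Ux.
pose F := filter_from [set: nat] (cylinder x).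
have FF : Filter F.
  apply: filter_from_filter; first by exists 0%N.
  move=> m n _ _; exists (maxn m n) => // y yx; split; apply: sub_cylinder yx.
    exact: leq_maxl.
  exact: leq_maxr.
have : F --> x.
  apply/cvg_sup => i A [_ [[V oV <-] Vx VA]].
  by exists i.+1 => // y yx; apply: VA => /=; rewrite /proj yx.
have nU : nbhs x U by apply: open_nbhs_nbhs.
by move=> /(_ U nU)[m _ mU]; exists m.
Qed.

Lemma subspace_open_cylinder {K : choiceType} {A : set (sequence_space K)}
    (U : set A) (x : A) :
  open U -> U x -> exists m, forall y : A, cylinder (\val x) m (\val y) -> U y.
Proof.
move=> [V oV <-] Vx; have [m mV] := open_cylinder V (\val x) oV Vx.
by exists m => y /mV.
Qed.

Lemma subspace_cylinder_open {K : choiceType} {A : set (sequence_space K)}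
    (x : sequence_space K) (m : nat) :
  open [set y : A | cylinder x m (\val y)].
Proof. by exists (cylinder x m) => //; exact: cylinder_open. Qed.

(** * Polish subspaces described by cylinders *)

Section polish_subspace.
Context {R : realType} {K : choiceType} (A : set (sequence_space K)).
Variables (d : A -> A -> R) (D : set A).
Hypotheses (dm : is_metric d) (dA : metric_induces d) (dc : metric_complete d).
Hypothesis (dD : dense D).

(** The bound [n <= m] forces centres of cylinders around a common point to agree with it on ever
    longer prefixes. *)
Definition small_cylinder (n : nat) (y : A) (m : nat) : Prop :=
  (n <= m)%N /\ forall z w : A, cylinder (\val y) m (\val z) ->
    cylinder (\val y) m (\val w) -> d z w < n.+1%:R^-1.

Lemma ball_open (x : A) (e : R) : open [set y | d x y < e].
Proof.
have [_ _ tri] := dm.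
apply/dA => y /= xy; exists (e - d x y); first by rewrite subr_gt0.
by move=> z /=; rewrite ltrBrDl => yz; apply: le_lt_trans yz.
Qed.

(** A point of the intersection is the coordinatewise limit of points of [A]; smallness makes these
    Cauchy, and by completeness their limit lies in [A]. *)
Lemma polish_subspace_Gdelta :
  A = \bigcap_n \bigcup_(p in [set p : A * nat | D p.1 /\ small_cylinder n p.1 p.2])
        cylinder (\val p.1) p.2.
Proof.
have [d0 dC tri] := dm.
apply/seteqP; split=> [x Ax n _|x xG].
  pose a : A := exist _ x (mem_set Ax).
  pose e : R := n.+1%:R^-1 / 2.
  have e0 : 0 < e by rewrite divr_gt0.
  have [|m0 m0e] := subspace_open_cylinder _ a (ball_open a e).
    by rewrite /= (d0 a a).2.
  pose m := maxn m0 n.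
  (* Density gives a new centre in [D]; a cylinder is centred at each of its points. *)
  have [||y [/= ay Dy]] := dD [set y : A | cylinder x m (\val y)].
  - by exists a.
  - exact: subspace_cylinder_open.
  exists (y, m) => /=; last by rewrite (cylinder_eq x (\val y)).
  split=> //; split; first exact: leq_maxr.
  move=> z w; rewrite (cylinder_eq x (\val y))// => xz xw.
  have zb : d a z < e by apply/m0e/(sub_cylinder _ _ m) => //; exact: leq_maxl.
  have wb : d a w < e by apply/m0e/(sub_cylinder _ _ m) => //; exact: leq_maxl.
  apply: le_lt_trans (tri z a w) _; rewrite (dC z a).
  by rewrite (splitr n.+1%:R^-1) ltrD.
have /choice[u uP] : forall m, exists y : A, cylinder x m (\val y).
  move=> m; have [[y k] /= [_ [mk _]] yx] := xG m I.
  by exists y => i im; rewrite yx//; exact: leq_trans mk.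
have cu : metric_cauchy_seq d u.
  move=> e e0; pose n := Num.truncn e^-1.
  have [[y k] /= [_ [_ sm]] yx] := xG n I.
  (* From index [k] on, the terms agree with [x] on [k] coordinates, hence lie in the small cylinder
     of [y]. *)
  exists k => p q kp kq; apply: lt_trans (sm _ _ _ _) _.
  - by move=> i ik; rewrite uP ?yx//; exact: leq_trans kp.
  - by move=> i ik; rewrite uP ?yx//; exact: leq_trans kq.
  - rewrite invf_plt ?posrE//; exact: truncnS_gt.
have [a ua] := dc _ cu.
suff -> : x = \val a by exact: set_valP.
apply/funext => i.
(* This cylinder is open for [d], so late terms agree with [a] at coordinate [i]; those of index
   above [i] also agree there with [x]. *)
have [e e0 eU] := (dA _).1 (subspace_cylinder_open (A := A) (\val a) i.+1) a
  (fun i _ => erefl).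
have [N uN] := ua e e0.
have aN : cylinder (\val a) i.+1 (\val (u (maxn N i.+1))).
  by apply: (eU (u (maxn N i.+1))); rewrite /= dC uN// leq_maxl.
by rewrite -(aN i)// (uP (maxn N i.+1))// leq_maxr.
Qed.

End polish_subspace.

(** * Borel preimages, and the number of blocks *)

Lemma measurable_preimage_polish {R : realType} {K : choiceType}
    {disp : measure_display} {T : measurableType disp}
    (f : T -> sequence_space K) (A : set (sequence_space K)) :
  (forall n k, measurable [set t | f t n = k]) ->
  polish_space R A -> measurable (f @^-1` A).
Proof.
move=> fm [[D cD dD] [d [dm dA dc]]].
have mcyl x m : measurable (f @^-1` cylinder x m).
  rewrite (_ : _ @^-1` _ =
      \bigcap_(i in [set i | (i < m)%N]) [set t | f t i = x i]) //.
  by apply: bigcap_measurableType => i _; exact: fm.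
rewrite (polish_subspace_Gdelta A d D dm dA dc dD) preimage_bigcap.
(* The union is reindexed by the subtype of its index set, which is countable as a part of [D] times
   [nat]. *)
apply: bigcap_measurableType => n _; rewrite preimage_bigcup bigcup_set_type.
apply: countable_bigcupT_measurable => [|p]; last exact: mcyl.
rewrite (eq_countable (card_setT _)).
have cDN : countable (D `*` [set: nat]) by exact: countableX.
apply: sub_countable cDN; apply: subset_card_le.
by move=> [y m] /= [Dy _]; split.
Qed.

(** Cylinders of length 1 fix the 0-th coordinate, so a dense subset of a block already takes all
    its 0-th coordinates; constant sequences reach every element of [K]. *)
Lemma polish_partition_uncountable {R : realType} {K : choiceType}
    (P : set (set (sequence_space K))) :
  ~ countable [set: K] -> polish_partition R P -> ~ countable P.
Proof.
move=> ncK [[cov _ _] Ppol] cP; apply: ncK.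
have /choice[C CP] : forall A, exists C : set K,
    P A -> countable C /\ forall x, A x -> C (x 0%N).
  move=> A; have [PA|nPA] := pselect (P A); last by exists set0.
  have [[D cD dD] _] := Ppol _ PA.
  exists [set (\val y : sequence_space K) 0%N | y in D] => _; split.
    exact: sub_countable (card_image_le _ _) cD.
  move=> x Ax; have [||y [/= xy Dy]] := dD [set y : A | cylinder x 1 (\val y)].
  - by exists (exist _ x (mem_set Ax)).
  - exact: subspace_cylinder_open.
  - by exists y => //; rewrite (xy 0%N).
have cC : countable (\bigcup_(A in P) C A).
  by apply: bigcup_countable => // A /CP[].
apply: sub_countable cC; apply: subset_card_le => k _.
have [A PA Ak] : cover P id ((fun=> k) : sequence_space K) by rewrite cov.
by exists A => //; have [_ /(_ _ Ak)] := CP A PA.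
Qed.

(** The equipotence labels the blocks by [K]: the fibres of [f] are the blocks, and it is onto
    because they are nonempty. *)
Lemma partition_index {R : realType} {K : choiceType} (P : set (set R)) :
  partition P id [set: R] -> P `<=` measurable -> P #= [set: K] ->
  exists f : R -> K, (forall k, measurable (f @^-1` [set k])) /\
    forall k, exists r, f r = k.
Proof.
move=> [cov triv ne] mP /card_bijP[h [g hK gK]].
have /choice[B BP] : forall r, exists B : P, (\val B) r.
  move=> r; have [B PB Br] : cover P id r by rewrite cov.
  by exists (exist _ B (mem_set PB)).
have Buniq (A : P) r : (\val A) r -> B r = A.
  move=> Ar; apply: val_inj; apply: triv; [exact: set_valP|exact: set_valP|].
  by exists r; split=> //; exact: BP.
exists (fun r => \val (h (B r))); split=> k.
  pose A := g (exist _ k (mem_set I)).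
  rewrite (_ : _ @^-1` _ = \val A); first exact: (mP _ (set_valP A)).
  apply/seteqP; split=> r /= => [hk|/Buniq->]; last by rewrite gK.
  suff -> : A = B r by exact: BP.
  by rewrite -(hK (B r)) /A; congr (g _); apply: val_inj; exact: esym hk.
have [r /Buniq Br] := ne _ (set_valP (g (exist _ k (mem_set I)))).
by exists r; rewrite Br gK.
Qed.

(** * Pulling a least Polish partition back to the reals *)

Theorem theorem4p3 (R : realType) (K : choiceType) :
  ~ countable [set: K] ->
  sp_Borel R [set: K] ->
  sp_Borel R (par R (prod_topology (fun _ : nat => discrete_topology K))).
Proof.
move=> ncK [P [partP borelP _ PK]].
have [f [fm fsurj]] : exists f : R -> K,
    (forall k, measurable (f @^-1` [set k])) /\ forall k, exists r, f r = k.
  by apply: (partition_index P) => // A /borelP/borel_measurable.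
pose psi (r : R) : sequence_space K := fun n => f (real_of_bits n r).
have psi_surj x : exists r, psi r = x.
  have /choice[s sx] : forall n, exists s, f s = x n by move=> n; exact: fsurj.
  have [r rs] := real_of_bits_surj s.
  by exists r; apply/funext => n; rewrite /psi rs.
have psim n k : measurable [set r | psi r n = k].
  rewrite -[X in measurable X]setTI.
  exact: (measurable_real_of_bits n measurableT _ (fm k)).
set X := prod_topology _.
have [[[cov triv ne] Ppol] _] := parP R X.
(* Preimage under a surjection is injective on sets, so pulling back keeps the cardinality. *)
have inj : {in par R X &, injective (fun A => psi @^-1` A)}.
  move=> A B _ _ /seteqP[AB BA]; apply/seteqP; split=> x.
    by have [r <-] := psi_surj x; exact: AB.
  by have [r <-] := psi_surj x; exact: BA.
have Pcard := inj_card_eq inj.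
exists [set psi @^-1` A | A in par R X]; split => //.
- split.
  + apply/seteqP; split=> // r _.
    have [A PA Ar] : cover (par R X) id (psi r) by rewrite cov.
    by exists (psi @^-1` A) => //; exists A.
  + move=> _ _ [A PA <-] [B PB <-] [r [/= Ar Br]].
    by rewrite (triv A B)//; exists (psi r).
  + move=> _ [A PA <-]; have [x Ax] := ne A PA.
    by have [r rx] := psi_surj x; exists r; rewrite /= rx.
- move=> _ [A PA <-]; apply/borel_measurable.
  exact: measurable_preimage_polish psim (Ppol A PA).
- rewrite (eq_countable Pcard).
  exact: (polish_partition_uncountable (R := R)) (parP R X).1.
Qed.
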